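(* Let $\theta\in[\tfrac12,1]$, $\tau>0$, $\epsilon>0$, $\beta>0$, $S_1>0$, $S_2>0$, and let $(\phi^n)_{n\ge 0}$ (functions on $\Omega$) and $(r^n)_{n\ge0}$ (real numbers) be a solution of the $\mathcal U_L$-method, i.e. for every $n\ge 1$, $$D_\tau^\theta\phi^{n+\theta}=\nabla\cdot\big(M^{*,n+\theta}\nabla\mu^{n+\theta}\big),$$ $$\mu^{n+\theta}=H^{*,n+\theta}r^{n+\theta}+\beta\Delta^2\phi^{n+\theta}+\frac{S_1}{\epsilon^2}(\phi^{n+1}-2\phi^n+\phi^{n-1})-S_2\Delta(\phi^{n+1}-2\phi^n+\phi^{n-1}),$$ $$D_\tau^\theta r^{n+\theta}=\frac12\int_\Omega H^{*,n+\theta}\,D_\tau^\theta\phi^{n+\theta}\,d\Omega ,$$ with starting values satisfying $\int_\Omega\phi^1d\Omega=\int_\Omega\phi^0d\Omega$. Then the scheme conserves mass: $$\int_\Omega\phi^{n+1}d\Omega=\int_\Omega\phi^{n}d\Omega=\cdots=\int_\Omega\phi^{0}d\Omega\qquad\text{for all } n\ge 0.$$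
   Context: $\Omega\subset\mathbb R^d$ ($d=2,3$) is a bounded domain; all functions satisfy periodic boundary conditions (so integration by parts produces no boundary terms) and are sufficiently regular that all expressions below are well defined. Anisotropic quantities: $\mathbf n=\nabla\phi/|\nabla\phi|$, $\gamma(\mathbf n)=1+\alpha\big(4\sum_{i=1}^d n_i^4-3\big)$ with $\alpha\ge0$, $F(\phi)=\frac14(\phi^2-1)^2$, $f(\phi)=F'(\phi)=\phi(\phi^2-1)$, $$\mathbf m=\gamma(\mathbf n)\nabla\phi+\frac{\mathbb P\nabla_{\mathbf n}\gamma(\mathbf n)}{|\nabla\phi|}\Big(\tfrac12|\nabla\phi|^2+\tfrac1{\epsilon^2}F(\phi)\Big),\qquad \mathbb P=\mathbb I-\mathbf n\mathbf n^T .$$ The mobility $M(\phi)\ge M_0>0$ is a function of $\phi$ or a constant. $$H(\phi)=\frac{\frac1{\epsilon^2}\gamma(\mathbf n)f(\phi)-\nabla\cdot\mathbf m}{\sqrt{\int_\Omega\gamma(\mathbf n)\big(\frac12|\nabla\phi|^2+\frac1{\epsilon^2}F(\phi)\big)d\Omega+C}},$$ where $C>0$ is a constant making the radicand positive. Time discretization with uniform step $\tau$: for any sequence $(u^n)$, $$D_\tau^\theta u^{n+\theta}=\frac{(\theta+\frac12)u^{n+1}-2\theta u^n+(\theta-\frac12)u^{n-1}}{\tau},\quad u^{n+\theta}=\theta u^{n+1}+(1-\theta)u^n$$ (the latter convention used for $\phi^{n+\theta}$ and $r^{n+\theta}$; $\mu^{n+\theta}$ is the function defined by the second equation of the scheme),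 $\phi^{*,n+\theta}=(1+\theta)\phi^n-\theta\phi^{n-1}$, $H^{*,n+\theta}=H(\phi^{*,n+\theta})$, $M^{*,n+\theta}=M(\phi^{*,n+\theta})$. *)

(* Defs.v *)
From HB Require Import structures.
From mathcomp Require Import all_boot all_order all_algebra.
From mathcomp Require Import all_classical all_reals all_analysis.
From mathcomp Require Import ring.

Set Implicit Arguments.
Unset Strict Implicit.
Unset Printing Implicit Defensive.

Import Order.TTheory GRing.Theory Num.Theory.
Import numFieldNormedType.Exports.

Local Open Scope classical_set_scope.
Local Open Scope ring_scope.

(* Lebesgue measure on R^n, by recursion on n: the product measure, carried
   from R * R^n to R^(n+1) by (x, t) |-> x :: t. *)
Section lebesgue_cons.
Context {R : realType} (n : nat).
Local Notation T := (measurableTypeR R).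
Variable nu : {sigma_finite_measure set (n.-tuple T) -> \bar R}.

Let tcons (p : T * n.-tuple T) : n.+1.-tuple T := [tuple of p.1 :: p.2].

Let measurable_tcons : measurable_fun [set: T * n.-tuple T] tcons.
Proof. exact: measurable_cons measurable_fst measurable_snd. Qed.

Let tuncons (t : n.+1.-tuple T) : T * n.-tuple T :=
  (tnth t ord0, [tuple of behead t]).

Let measurable_tuncons : measurable_fun [set: n.+1.-tuple T] tuncons.
Proof.
exact: measurable_fun_pair (measurable_tnth ord0) (@measurable_behead _ T n).
Qed.

Let tconsK : cancel tcons tuncons.
Proof. by case=> x t; congr pair; apply/val_inj. Qed.

Let tunconsK : cancel tuncons tcons.
Proof. by move=> t; rewrite [RHS]tuple_eta. Qed.

Definition lebesgue_cons : set (n.+1.-tuple T) -> \bar R :=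
  pushforward (@lebesgue_measure R \x nu)%E tcons.

Let lebesgue_cons0 : lebesgue_cons set0 = 0%E.
Proof. by rewrite /lebesgue_cons /pushforward preimage_set0 measure0. Qed.

Let lebesgue_cons_ge0 A : (0 <= lebesgue_cons A)%E.
Proof. exact: measure_ge0. Qed.

Let lebesgue_cons_sigma_additive : semi_sigma_additive lebesgue_cons.
Proof.
move=> F mF tF mUF; rewrite /lebesgue_cons /pushforward preimage_bigcup.
apply: measure_semi_sigma_additive.
- by move=> k; rewrite -[X in measurable X]setTI; exact: measurable_tcons.
- apply/trivIsetP => /= i j _ _ ij; rewrite -preimage_setI.
  by move/trivIsetP : tF => /(_ _ _ _ _ ij) ->//; rewrite preimage_set0.
- by rewrite -preimage_bigcup -[X in measurable X]setTI; exact: measurable_tcons.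
Qed.

HB.instance Definition _ := isMeasure.Build _ _ _ lebesgue_cons
  lebesgue_cons0 lebesgue_cons_ge0 lebesgue_cons_sigma_additive.

Let lebesgue_cons_sigma_finite : sigma_finite setT lebesgue_cons.
Proof.
have [F TF Foo] : sigma_finite setT (@lebesgue_measure R \x nu)%E.
  have /sigma_finiteP[F [TF ndF Foo]] := sigma_finiteT (@lebesgue_measure R).
  have /sigma_finiteP[G [TG ndG Goo]] := sigma_finiteT nu.
  exists (fun k => F k `*` G k).
    rewrite -setXTT TF TG predeqE => -[x y]; split.
      move=> [/= [k _ Fkx] [l _ Gly]]; exists (maxn k l) => //; split.
      - by move: x Fkx; exact/subsetPset/ndF/leq_maxl.
      - by move: y Gly; exact/subsetPset/ndG/leq_maxr.
    by move=> [k _ []/= ? ?]; split; exists k.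
  move=> k; have [? ?] := Foo k; have [? ?] := Goo k.
  split; first exact: measurableX.
  by rewrite product_measure1E// lte_mul_pinfty// ge0_fin_numE.
exists (fun k => tuncons @^-1` F k).
  by rewrite -preimage_bigcup -TF preimage_setT.
move=> k; have [mF Fk] := Foo k; split.
  by rewrite -[X in measurable X]setTI; exact: measurable_tuncons.
rewrite /lebesgue_cons /pushforward -comp_preimage.
rewrite (_ : tuncons \o tcons = id) ?preimage_id//.
by apply/funext => p /=; rewrite tconsK.
Qed.

HB.instance Definition _ := Measure_isSigmaFinite.Build _ _ _ lebesgue_cons
  lebesgue_cons_sigma_finite.

End lebesgue_cons.

Fixpoint lebesgueRn (R : realType) (n : nat) :
    {sigma_finite_measure set (n.-tuple (measurableTypeR R)) -> \bar R} :=
  match n with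
  | 0 => dirac [tuple]
  | k.+1 => lebesgue_cons (lebesgueRn R k)
  end.

Section calculus.
Context {R : realType} {d : nat}.
Implicit Types (f : 'rV[R]_d -> R) (G : 'rV[R]_d -> 'rV[R]_d).

Definition basis (i : 'I_d) : 'rV[R]_d := delta_mx 0 i.

Definition partial (i : 'I_d) f (x : 'rV[R]_d) : R := 'D_(basis i) f x.

Definition grad f (x : 'rV[R]_d) : 'rV[R]_d := \row_i partial i f x.

Definition divergence G (x : 'rV[R]_d) : R :=
  \sum_(i < d) partial i (fun y => G y 0 i) x.

Definition lap f : 'rV[R]_d -> R := divergence (grad f).

Fixpoint class_C (k : nat) f : Prop :=
  match k with
  | 0 => continuous f
  | k'.+1 => (forall x, differentiable f x) /\
             forall i, class_C k' (partial i f)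
  end.

(* The norm `|v| of the library on row vectors is the sup norm. *)
Definition enorm (v : 'rV[R]_d) : R := Num.sqrt (\sum_(i < d) v 0 i ^+ 2).

End calculus.

Section domain.
Context {R : realType} {d : nat} (a b : 'rV[R]_d).
Local Notation T := (measurableTypeR R).

Definition box : set 'rV[R]_d := [set x | forall i, a 0 i < x 0 i < b 0 i].

(* A function on the box with periodic boundary conditions is represented by
   its periodic extension to R^d. *)
Definition box_periodic (f : 'rV[R]_d -> R) : Prop :=
  forall (i : 'I_d) x, f (x + (b 0 i - a 0 i) *: basis i) = f x.

Definition row_of_tuple (t : d.-tuple T) : 'rV[R]_d := \row_i tnth t i.

Definition integrable_box (f : 'rV[R]_d -> R) : Prop :=
  (lebesgueRn R d).-integrable (row_of_tuple @^-1` box) 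
    (EFin \o (f \o row_of_tuple)).

Definition integral_box (f : 'rV[R]_d -> R) : R :=
  Rintegral (lebesgueRn R d) (row_of_tuple @^-1` box) (f \o row_of_tuple).

Definition ae_box (P : 'rV[R]_d -> Prop) : Prop :=
  {ae lebesgueRn R d, forall t, box (row_of_tuple t) -> P (row_of_tuple t)}.

End domain.

Definition Fpot {R : realType} (s : R) : R := (s ^+ 2 - 1) ^+ 2 / 4.

Definition fpot {R : realType} (s : R) : R := s * (s ^+ 2 - 1).

Lemma derive1_Fpot (R : realType) : derive1 (@Fpot R) = @fpot R.
Proof.
apply/funext => s; rewrite derive1E /Fpot /fpot.
have H : is_derive s (1 : R) (fun x : R => (x ^+ 2 - 1) ^+ 2 / 4)
    (s * (s ^+ 2 - 1)).
  by apply: is_derive_eq; rewrite /GRing.scale /=; field.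
exact: derive_val.
Qed.

Section anisotropy.
Context {R : realType} {d : nat} (alpha eps : R).
Implicit Types (phi : 'rV[R]_d -> R) (x n : 'rV[R]_d).

Definition gamma n : R := 1 + alpha * (4 * (\sum_(i < d) n 0 i ^+ 4) - 3).

(* Where grad phi x = 0 the formula has no meaning; since 0^-1 = 0, the normal
   is then 0. A periodic function always has such critical points: relations
   that involve H are to be asked for almost everywhere. *)
Definition normal phi x : 'rV[R]_d := (enorm (grad phi x))^-1 *: grad phi x.

(* Vectors are rows: v *m proj n is the transpose of (I - n n^T) v^T. *)
Definition proj n : 'M[R]_d := 1%:M - n^T *m n.

Definition density phi x : R :=
  2^-1 * enorm (grad phi x) ^+ 2 + (eps ^+ 2)^-1 * Fpot (phi x).

Definition mvec phi x : 'rV[R]_d :=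
  gamma (normal phi x) *: grad phi x +
  (density phi x / enorm (grad phi x)) *:
    (grad gamma (normal phi x) *m proj (normal phi x)).

Definition energy_density phi x : R := gamma (normal phi x) * density phi x.

Definition Hfun (a b : 'rV[R]_d) (C : R) phi x : R :=
  ((eps ^+ 2)^-1 * gamma (normal phi x) * fpot (phi x) - divergence (mvec phi) x) /
  Num.sqrt (integral_box a b (energy_density phi) + C).

End anisotropy.

Section time_discretization.
Context {R : realType} (theta tau : R).

(* Values at time n + theta, for n >= 1. *)
Definition Dtheta (u : nat -> R) (n : nat) : R :=
  ((theta + 2^-1) * u n.+1 - 2 * theta * u n + (theta - 2^-1) * u n.-1) / tau.

Definition mid (u : nat -> R) (n : nat) : R :=
  theta * u n.+1 + (1 - theta) * u n.

Definition extrap (u : nat -> R) (n : nat) : R :=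
  (1 + theta) * u n - theta * u n.-1.

Definition second_diff (u : nat -> R) (n : nat) : R :=
  u n.+1 - 2 * u n + u n.-1.

(* A step operator applied pointwise to a sequence of functions. *)
Definition ptw {X : Type} (op : (nat -> R) -> nat -> R)
  (phi : nat -> X -> R) (n : nat) (x : X) : R := op (fun k => phi k x) n.

End time_discretization.

(* Main.v *)
(* Integrating the first equation of the scheme over the box, the right-hand
   side vanishes: by Fubini and the fundamental theorem of calculus, the
   integral of a partial derivative d_i g is the integral of the jump of g
   across the box in direction i, which is zero since g, a component of the
   flux, is periodic. Hence the masses I_n satisfy
   (theta + 1/2) I_(n+1) - 2 theta I_n + (theta - 1/2) I_(n-1) = 0, a recurrence
   whose coefficients sum to 0, so I_1 = I_0 makes I constant. *)
Require Import Defs.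
From HB Require Import structures.
From mathcomp Require Import all_boot all_order all_algebra.
From mathcomp Require Import all_classical all_reals all_analysis.
From mathcomp Require Import measurable_realfun ring.

Set Implicit Arguments.
Unset Strict Implicit.
Unset Printing Implicit Defensive.

Import Order.TTheory GRing.Theory Num.Theory.
Import numFieldNormedType.Exports.

Local Open Scope classical_set_scope.
Local Open Scope ring_scope.

(** * Measurability and integrability of continuous functions on boxes *)

Section integration_on_boxes.
Context {R : realType}.
Local Notation T := (measurableTypeR R).
Local Notation leb := (@lebesgue_measure R).

Definition tuple_box n (a b : 'rV[R]_n) : set (n.-tuple T) :=
  row_of_tuple @^-1` box a b.

Lemma tuple_boxE n (a b : 'rV[R]_n) :
  tuple_box a b =
  \bigcap_i ((fun t : n.-tuple T => tnth t i) @^-1` `]a 0 i, b 0 i[).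
Proof.
apply/seteqP; split=> t /= abt i.
  by move=> _; have := abt i; rewrite mxE /= in_itv.
by have := abt i I; rewrite mxE /= in_itv.
Qed.

Lemma measurable_tuple_box n (a b : 'rV[R]_n) : measurable (tuple_box a b).
Proof.
rewrite tuple_boxE; apply: fin_bigcap_measurable => // i _.
rewrite -[X in measurable X]setTI.
by apply: measurable_tnth => //; exact: measurable_itv.
Qed.

(** Rational points are dense and balls of the sup norm are cubes, so every point of [U] lies in a
    rational box inside [U]. The index type is countable: this links the topology of rows to the
    sigma-algebra on tuples, generated by the coordinates. *)
Lemma open_bigcup_box n (U : set 'rV[R]_n) : open U ->
  U = \bigcup_(pq : 'rV[rat]_n * 'rV[rat]_n)
        (if `[< box (map_mx ratr pq.1) (map_mx ratr pq.2) `<=` U >]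
         then box (map_mx ratr pq.1) (map_mx ratr pq.2) else set0).
Proof.
move=> oU; apply/seteqP; split=> [x Ux|x [pq _]]; last first.
  by case: asboolP => // + ?; exact.
have /nbhs_ballP[e /= e0 xeU] : nbhs x U by exact: open_nbhs_nbhs.
have /choice[p xp] : forall i, exists q : rat,
    ratr q \in `](x 0 i - e), (x 0 i)[.
  by move=> i; apply: rat_in_itvoo; rewrite ltrBlDr ltrDl.
have /choice[q xq] : forall i, exists q : rat,
    ratr q \in `](x 0 i), (x 0 i + e)[.
  by move=> i; apply: rat_in_itvoo; rewrite ltrDl.
exists (\row_i p i, \row_i q i) => //=; case: asboolP => [_ i|].
  rewrite !mxE; move: (xp i) (xq i); rewrite !in_itv/=.
  by move=> /andP[_ ->] /andP[->].
case=> y pqy; apply: xeU; split => // i j; rewrite ord1 /ball/=.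
have := pqy j; rewrite !mxE distrC; move: (xp j) (xq j); rewrite !in_itv/=.
move=> /andP[xp1 _] /andP[_ xq2] /andP[py yq].
by rewrite ltr_distl (lt_trans xp1 py) (lt_trans yq xq2).
Qed.

Lemma measurable_preimage_open n (U : set 'rV[R]_n) : open U ->
  measurable ((@row_of_tuple R n) @^-1` U).
Proof.
move=> /open_bigcup_box ->; rewrite preimage_bigcup.
apply: countable_bigcupT_measurable => // pq.
case: ifP => _; first exact: measurable_tuple_box.
by rewrite preimage_set0; exact: measurable0.
Qed.

Lemma continuous_measurable_row n (f : 'rV[R]_n -> R) : continuous f ->
  measurable_fun [set: n.-tuple T] (f \o @row_of_tuple R n).
Proof.
move=> cf; apply: (measurability _ (RGenOpens.measurableE R)).
move=> _ [_ [a [b ->] <-]]; rewrite setTI comp_preimage.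
apply: measurable_preimage_open; apply: open_comp; last exact: itv_open.
by move=> x _; exact: cf.
Qed.

(** The open box lies in the closed one, a compact product of segments. *)
Lemma continuous_bounded_box n (a b : 'rV[R]_n) (f : 'rV[R]_n -> R) :
  continuous f -> [bounded f (row_of_tuple t) | t in tuple_box a b].
Proof.
move=> cf.
have /compact_bounded[M [Mr fM]] :
    compact (f @` [set v : 'rV[R]_n | forall i, v ord0 i \in `[a 0 i, b 0 i]]).
  apply: continuous_compact; first exact: continuous_subspaceT.
  apply: (@rV_compact _ n (fun i => `[a 0 i, b 0 i]%classic)) => i.
  exact: segment_compact.
exists M; split=> // r Mr' t abt; apply: (fM r Mr').
exists (row_of_tuple t) => //= i; rewrite in_itv/=.
by have /andP[/ltW-> /ltW->] := abt i.
Qed.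

(** * Splitting off the first coordinate *)

Definition cons_row n (s : R) (y : 'rV[R]_n) : 'rV[R]_n.+1 :=
  \row_i (if unlift ord0 i is Some j then y 0 j else s).

Definition behead_row n (y : 'rV[R]_n.+1) : 'rV[R]_n :=
  \row_j y 0 (lift ord0 j).

(** The map along which [lebesgue_cons] pushes the product measure forward; [lebesgueRnS] then holds
    by conversion. *)
Definition tuple_cons n (p : T * n.-tuple T) : n.+1.-tuple T :=
  [tuple of p.1 :: p.2].

Lemma cons_row0 n s (y : 'rV[R]_n) : cons_row s y 0 ord0 = s.
Proof. by rewrite mxE unlift_none. Qed.

Lemma cons_rowS n s (y : 'rV[R]_n) j : cons_row s y 0 (lift ord0 j) = y 0 j.
Proof. by rewrite mxE liftK. Qed.

Lemma cons_rowP n (x : 'rV[R]_n.+1) s (y : 'rV[R]_n) :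
  x 0 ord0 = s -> (forall j, x 0 (lift ord0 j) = y 0 j) -> x = cons_row s y.
Proof.
move=> x0 xS; apply/rowP => i; have [j ->|->] := unliftP ord0 i.
  by rewrite cons_rowS.
by rewrite cons_row0.
Qed.

Lemma row_of_tuple_cons n (p : T * n.-tuple T) :
  row_of_tuple (tuple_cons p) = cons_row p.1 (row_of_tuple p.2).
Proof.
apply: cons_rowP => [|j]; first by rewrite mxE.
by rewrite !mxE tnthS.
Qed.

Lemma tuple_box_cons n (a b : 'rV[R]_n.+1) :
  (@tuple_cons n) @^-1` tuple_box a b =
  `]a 0 ord0, b 0 ord0[ `*` tuple_box (behead_row a) (behead_row b).
Proof.
apply/seteqP; split=> -[s t]; rewrite /tuple_box /box /=.
  move=> abst; split => [|i].
    by have := abst ord0; rewrite row_of_tuple_cons cons_row0 in_itv.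
  by have := abst (lift ord0 i); rewrite row_of_tuple_cons cons_rowS !mxE.
rewrite in_itv/= => -[abs abt] i; have [j ->|->] := unliftP ord0 i.
  by rewrite row_of_tuple_cons cons_rowS; have := abt j; rewrite !mxE.
by rewrite row_of_tuple_cons cons_row0.
Qed.

Lemma continuous_cons_row_r n s : continuous (@cons_row n s).
Proof.
move=> y A /nbhs_ballP[e /= e0 eA]; apply/nbhs_ballP; exists e => //= z [_ yz].
apply: eA; split => // i j; rewrite ord1; have [k ->|->] := unliftP ord0 j.
  by rewrite !cons_rowS.
by rewrite !cons_row0; exact: ballxx.
Qed.

Lemma continuous_cons_row_l n (y : 'rV[R]_n) : continuous (@cons_row n ^~ y).
Proof.
move=> s A /nbhs_ballP[e /= e0 eA]; apply/nbhs_ballP; exists e => //= z sz.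
apply: eA; split => // i j; rewrite ord1; have [k ->|->] := unliftP ord0 j.
  by rewrite !cons_rowS; exact: ballxx.
by rewrite !cons_row0.
Qed.

Lemma measurable_tuple_cons n :
  measurable_fun [set: T * n.-tuple T] (@tuple_cons n).
Proof. exact: measurable_cons measurable_fst measurable_snd. Qed.

Lemma lebesgueRnS n (A : set (n.+1.-tuple T)) :
  lebesgueRn R n.+1 A = (leb \x lebesgueRn R n)%E (@tuple_cons n @^-1` A).
Proof. by []. Qed.

Lemma lebesgueRn_tuple_box_lty n (a b : 'rV[R]_n) :
  (lebesgueRn R n (tuple_box a b) < +oo)%E.
Proof.
elim: n a b => [|n IHn] a b.
  by rewrite /= diracE; case: (_ \in _); rewrite ltry.
rewrite lebesgueRnS tuple_box_cons product_measure1E//; last first.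
  exact: measurable_tuple_box.
rewrite lte_mul_pinfty// ?ge0_fin_numE//.
rewrite [X in (X < _)%E](lebesgue_measure_itv `]a 0 ord0, b 0 ord0[).
by case: ifP => _ //=; rewrite -EFinB ltry.
Qed.

Lemma continuous_integrable_box n (a b : 'rV[R]_n) (f : 'rV[R]_n -> R) :
  continuous f -> integrable_box a b f.
Proof.
move=> cf; apply: measurable_bounded_integrable.
- exact: measurable_tuple_box.
- exact: lebesgueRn_tuple_box_lty.
- by apply: measurable_funTS; exact: continuous_measurable_row.
- exact: continuous_bounded_box.
Qed.

Lemma continuous_integrable_cons_box n (a b : 'rV[R]_n.+1)
    (f : 'rV[R]_n.+1 -> R) : continuous f ->
  (leb \x lebesgueRn R n)%E.-integrable
    (`]a 0 ord0, b 0 ord0[ `*` tuple_box (behead_row a) (behead_row b))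
    (EFin \o f \o @row_of_tuple R n.+1 \o @tuple_cons n).
Proof.
move=> cf; rewrite -tuple_box_cons; apply: measurable_bounded_integrable.
- rewrite -[X in measurable X]setTI; apply: measurable_tuple_cons => //.
  exact: measurable_tuple_box.
- exact: (lebesgueRn_tuple_box_lty a b).
- apply: measurable_funTS.
  exact: measurableT_comp (continuous_measurable_row cf)
    (@measurable_tuple_cons n).
- have [M [Mr fM]] := @continuous_bounded_box _ a b f cf.
  by exists M; split=> // r Mr' t abt; exact: fM.
Qed.

(** Change of variables for a pushforward measure; it turns an integral in dimension [n.+1] into one
    to which Fubini applies. *)
Lemma integral_tuple_box_cons n (a b : 'rV[R]_n.+1)
    (f : 'rV[R]_n.+1 -> R) : continuous f ->
  (\int[lebesgueRn R n.+1]_(t in tuple_box a b) (f (row_of_tuple t))%:E =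
   \int[leb \x lebesgueRn R n]_(p in
      `]a 0%R ord0, b 0%R ord0[ `*` tuple_box (behead_row a) (behead_row b))
     (f (cons_row p.1 (row_of_tuple p.2)))%:E)%E.
Proof.
move=> cf.
have mf : measurable_fun [set: n.+1.-tuple T]
    (EFin \o (f \o @row_of_tuple R n.+1)).
  by apply/measurable_EFinP; exact: continuous_measurable_row.
have intf := continuous_integrable_cons_box a b cf.
rewrite -tuple_box_cons in intf *.
transitivity (\int[leb \x lebesgueRn R n]_(p in
      @tuple_cons n @^-1` tuple_box a b)
    ((EFin \o (f \o @row_of_tuple R n.+1)) \o @tuple_cons n) p)%E.
  rewrite -(integral_pushforward (@measurable_tuple_cons n) mf intf)//.
  exact: measurable_tuple_box.
by apply: eq_integral => p _ /=; rewrite row_of_tuple_cons.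
Qed.

End integration_on_boxes.

(** * Fubini on a product of measurable sets *)

Section integral_setX.
Context d1 d2 (T1 : measurableType d1) (T2 : measurableType d2) (R : realType).
Variable m1 : {sigma_finite_measure set T1 -> \bar R}.
Variable m2 : {sigma_finite_measure set T2 -> \bar R}.
Variables (A : set T1) (B : set T2) (f : T1 * T2 -> \bar R).
Hypotheses (mA : measurable A) (mB : measurable B).
Hypothesis intf : (m1 \x m2)%E.-integrable (A `*` B) f.

Let intfAB : (m1 \x m2)%E.-integrable setT (f \_ (A `*` B)).
Proof. by apply/(integrable_mkcond _ _).1 => //; exact: measurableX. Qed.

(** Fubini on the whole product is applied to the extension of [f] by zero; for [x] outside [A] the
    inner integral is that of zero. *)
Lemma integral12_setX :
  (\int[m1 \x m2]_(p in A `*` B) f p =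
   \int[m1]_(x in A) \int[m2]_(y in B) f (x, y))%E.
Proof.
rewrite integral_mkcond -integral12_prod_meas1// [RHS]integral_mkcond.
apply: eq_integral => x _; rewrite patchE; case: ifPn => [xA|xA].
  rewrite [RHS]integral_mkcond; apply: eq_integral => y _.
  by rewrite !patchE in_setX xA.
by apply: integral0_eq => y _; rewrite patchE in_setX (negbTE xA).
Qed.

Lemma integral21_setX :
  (\int[m1 \x m2]_(p in A `*` B) f p =
   \int[m2]_(y in B) \int[m1]_(x in A) f (x, y))%E.
Proof.
rewrite integral_mkcond -integral21_prod_meas1// [RHS]integral_mkcond.
apply: eq_integral => y _; rewrite patchE; case: ifPn => [yB|yB].
  rewrite [RHS]integral_mkcond; apply: eq_integral => x _.
  by rewrite !patchE in_setX yB andbT.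
by apply: integral0_eq => x _; rewrite patchE in_setX (negbTE yB) andbF.
Qed.

End integral_setX.

(** * Calculus along a line *)

Lemma integral_itv_derive (R : realType) (g h : R -> R) (a b : R) : a < b ->
  continuous h -> (forall x : R, is_derive x (1 : R) g (h x)) ->
  (\int[lebesgue_measure]_(x in `]a, b[) (h x)%:E = (g b - g a)%:E)%E.
Proof.
move=> ab ch dg.
have cg : continuous g.
  by move=> x; apply: differentiable_continuous; apply/derivable1_diffP.
(* The endpoints are negligible: the integral is moved to the closed interval, the setting of the
   fundamental theorem. *)
rewrite -(integral_itv_bndoo true false); last first.
  apply: measurable_funTS; apply/measurable_EFinP.
  exact: continuous_measurable_fun.
rewrite (@continuous_FTC2 _ h g)//.
- exact: continuous_subspaceT.
- split; first by move=> x _.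
  + by apply: cvg_at_right_filter; exact: cg.
  + by apply: cvg_at_left_filter; exact: cg.
- by move=> x _; rewrite derive1E; exact: derive_val.
Qed.

(** Since [c] sends the line through [x] along [u] to the line through [c x] along [v], the two
    difference quotients are the same function of [k]. *)
Lemma is_derive_comp_line (R : numFieldType) (U V W : normedModType R)
    (c : U -> V) (g : V -> W) (x u : U) (v : V) (l : W) :
  (forall k : R, c (k *: u + x) = k *: v + c x) ->
  is_derive (c x) v g l -> is_derive x u (g \o c) l.
Proof.
move=> cE [dg gE].
have quotE : (fun k => k^-1 *: (((g \o c) \o shift x) (k *: u) - (g \o c) x)) =
             (fun k => k^-1 *: ((g \o shift (c x)) (k *: v) - g (c x))).
  by apply/funext => k /=; rewrite cE.
split; first by rewrite /derivable quotE.
by rewrite -gE /derive quotE.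
Qed.

(** * Vanishing of integrals of derivatives of periodic functions *)

Section periodic_integrals.
Context {R : realType}.

(* [basis] alone would be the topological one of MathComp-Analysis. *)
Lemma cons_row_addZ0 n s (y : 'rV[R]_n) k :
  cons_row (k + s) y = k *: Defs.basis ord0 + cons_row s y.
Proof.
apply/esym/cons_rowP => [|j]; rewrite !mxE ?unlift_none ?liftK ?eqxx/=.
  by rewrite mulr1.
by rewrite mulr0 add0r.
Qed.

Lemma cons_row_addZS n s (y : 'rV[R]_n) k j :
  cons_row s (k *: Defs.basis j + y) =
  k *: Defs.basis (lift ord0 j) + cons_row s y.
Proof.
apply/esym/cons_rowP => [|i]; rewrite !mxE ?unlift_none ?liftK ?eqxx/=.
  by rewrite mulr0 add0r.
by rewrite (inj_eq lift_inj).
Qed.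

(** Induction on the dimension. Differentiability and periodicity of [g] are asked in direction [i]
    only, and [h] is kept separate from [g], so that the hypotheses pass to slices. *)
Lemma integral_partial_periodic n (a b : 'rV[R]_n) i (g h : 'rV[R]_n -> R) :
  (forall j, a 0 j < b 0 j) -> continuous h ->
  (forall x, is_derive x (Defs.basis i) g (h x)) ->
  (forall x, g (x + (b 0 i - a 0 i) *: Defs.basis i) = g x) ->
  (\int[lebesgueRn R n]_(t in tuple_box a b) (h (row_of_tuple t))%:E = 0)%E.
Proof.
elim: n a b i g h => [a b []//|n IHn a b i g h ab ch dg pg].
rewrite integral_tuple_box_cons//.
have mbox := measurable_tuple_box (behead_row a) (behead_row b).
have inth := continuous_integrable_cons_box a b ch.
have {}inth : (lebesgue_measure \x lebesgueRn R n)%E.-integrable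
    (`]a 0 ord0, b 0 ord0[ `*` tuple_box (behead_row a) (behead_row b))
    (fun p => (h (cons_row p.1 (row_of_tuple p.2)))%:E).
  by move: inth; congr (integrable _ _ _); apply/funext => p /=;
    rewrite row_of_tuple_cons.
have [j ij|i0] := unliftP ord0 i.
  (* Direction [i] is among the remaining coordinates: with the first one frozen at [s], the inner
     integral vanishes by induction. *)
  rewrite integral12_setX//; apply: integral0_eq => s _ /=.
  apply: (IHn _ _ j (g \o cons_row s) (h \o cons_row s)) => [k|x|x|x] /=.
  - by rewrite !mxE.
  - by apply: continuous_comp; [exact: continuous_cons_row_r|exact: ch].
  - apply: is_derive_comp_line (dg _) => k.
    by rewrite ij cons_row_addZS.
  - by rewrite !mxE -ij addrC cons_row_addZS -ij addrC pg.
(* Direction [i] is the first coordinate: it is integrated first, the others being frozen at [t]. *)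
rewrite integral21_setX//; apply: integral0_eq => t _ /=.
pose y : 'rV[R]_n := row_of_tuple t.
have cy : continuous (h \o @cons_row R n ^~ y).
  by move=> s; apply: continuous_comp; [exact: continuous_cons_row_l|exact: ch].
have dy s : is_derive s (1 : R) (g \o @cons_row R n ^~ y) (h (cons_row s y)).
  apply: is_derive_comp_line (dg _) => k.
  by rewrite i0 -cons_row_addZ0 [_%:A]mulr1.
rewrite (integral_itv_derive (ab ord0) cy dy) /=.
(* Writing [b] as [(b - a) + a] in this coordinate shows the upper endpoint as the lower one
   translated by a period. *)
rewrite -[b 0 ord0](subrK (a 0 ord0)) cons_row_addZ0 -i0 (addrC (_ *: _)) pg.
by rewrite subrr.
Qed.

Section box.
Variables (d : nat) (a b : 'rV[R]_d).
Implicit Types f g : 'rV[R]_d -> R.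

Lemma integral_boxZ k f : continuous f ->
  integral_box a b (fun x => k * f x) = k * integral_box a b f.
Proof.
move=> cf; rewrite /integral_box -RintegralZl//.
  exact: measurable_tuple_box.
exact: continuous_integrable_box.
Qed.

Lemma integral_boxD f g : continuous f -> continuous g ->
  integral_box a b (fun x => f x + g x) =
  integral_box a b f + integral_box a b g.
Proof.
move=> cf cg; rewrite /integral_box -RintegralD//.
- exact: measurable_tuple_box.
- exact: continuous_integrable_box.
- exact: continuous_integrable_box.
Qed.

Lemma eq_integral_box f g : (forall x, box a b x -> f x = g x) ->
  integral_box a b f = integral_box a b g.
Proof. by move=> fg; apply: eq_Rintegral => t /set_mem; exact: fg. Qed.

Lemma class_C_continuous k f : class_C k f -> continuous f.
Proof. by case: k => //= k [df _] x; exact: differentiable_continuous. Qed.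

Lemma integral_box_partial i f : (forall j, a 0 j < b 0 j) -> class_C 1 f ->
  (forall x, f (x + (b 0 i - a 0 i) *: Defs.basis i) = f x) ->
  integral_box a b (partial i f) = 0.
Proof.
move=> ab [df cf] pf; rewrite /integral_box /Rintegral.
have dfi x : is_derive x (Defs.basis i) f (partial i f x).
  by apply: derivableP; exact: diff_derivable.
by rewrite (integral_partial_periodic ab (cf i) dfi pf).
Qed.

Lemma integral_box_divergence (G : 'rV[R]_d -> 'rV[R]_d) :
  (forall j, a 0 j < b 0 j) -> (forall i, class_C 1 (fun x => G x 0 i)) ->
  (forall i x, G (x + (b 0 i - a 0 i) *: Defs.basis i) 0 i = G x 0 i) ->
  integral_box a b (divergence G) = 0.
Proof.
move=> ab CG pG; rewrite /divergence.
(* The sum is generalized to any list of indices for an induction; continuity is carried along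
   because additivity of the integral asks for it. *)
pose S (s : seq 'I_d) x := \sum_(i <- s) partial i (fun y => G y 0 i) x.
suff : forall s, continuous (S s) /\ integral_box a b (S s) = 0.
  by move=> /(_ (index_enum 'I_d))[].
elim=> [|i s [cs Is]].
  have -> : S [::] = cst 0 by apply/funext => x; rewrite /S big_nil.
  by split; [exact: cst_continuous|rewrite /integral_box /Rintegral integral0].
have cG : continuous (partial i (fun y => G y 0 i)) := (CG i).2 i.
have -> : S (i :: s) = (fun x => partial i (fun y => G y 0 i) x + S s x).
  by apply/funext => x; rewrite /S big_cons.
split; first by move=> x; apply: continuousD; [exact: cG|exact: cs].
by rewrite integral_boxD// Is integral_box_partial// addr0.
Qed.

(** Translation by a period does not change the difference quotients. This makes the gradient of
    [mu n], hence the flux, periodic. *)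
Lemma partial_periodic i j f : box_periodic a b f ->
  forall x, partial j f (x + (b 0 i - a 0 i) *: Defs.basis i) = partial j f x.
Proof.
move=> pf x; rewrite /partial /derive.
set q1 := fun k => k^-1 *: _; set q2 := fun k => k^-1 *: _.
suff -> : q1 = q2 by [].
by apply/funext => k; rewrite /q1 /q2 /= addrA !pf.
Qed.

End box.
End periodic_integrals.

(** * Conservation of mass *)

Theorem theorem3p2 (R : realType) (d : nat) (hd : d = 2%N \/ d = 3%N)
  (a b : 'rV[R]_d) (hab : forall i, a 0 i < b 0 i)
  (alpha eps beta S1 S2 C theta tau M0 : R) (M : R -> R)
  (halpha : 0 <= alpha) (heps : 0 < eps) (hbeta : 0 < beta)
  (hS1 : 0 < S1) (hS2 : 0 < S2) (hC : 0 < C)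
  (htheta : 2^-1 <= theta <= 1) (htau : 0 < tau)
  (hM0 : 0 < M0) (hM : forall s, M0 <= M s)
  (* mu n stands for mu^{n+theta} *)
  (phi mu : nat -> 'rV[R]_d -> R) (r : nat -> R)
  (phi_periodic : forall n, box_periodic a b (phi n))
  (mu_periodic : forall n, (1 <= n)%N -> box_periodic a b (mu n))
  (phi_regular : forall n, class_C 4 (phi n))
  (mu_regular : forall n, (1 <= n)%N -> forall x, differentiable (mu n) x)
  (flux_regular : forall n, (1 <= n)%N -> forall i,
     class_C 1 (fun x => (M (ptw (extrap theta) phi n x) *: grad (mu n) x) 0 i))
  (m_regular : forall n, (1 <= n)%N ->
     ae_box a b (fun x =>
       differentiable (mvec alpha eps (ptw (extrap theta) phi n)) x))
  (energy_regular : forall n, (1 <= n)%N ->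
     integrable_box a b
       (energy_density alpha eps (ptw (extrap theta) phi n)))
  (radicand_pos : forall n, (1 <= n)%N ->
     0 < integral_box a b
           (energy_density alpha eps (ptw (extrap theta) phi n)) + C)
  (Hphi_regular : forall n, (1 <= n)%N ->
     integrable_box a b (fun x =>
       Hfun alpha eps a b C (ptw (extrap theta) phi n) x *
       ptw (Dtheta theta tau) phi n x))
  (scheme_phi : forall n, (1 <= n)%N -> forall x, box a b x ->
     ptw (Dtheta theta tau) phi n x =
     divergence (fun y => M (ptw (extrap theta) phi n y) *: grad (mu n) y) x)
  (scheme_mu : forall n, (1 <= n)%N -> ae_box a b (fun x =>
     mu n x =
       Hfun alpha eps a b C (ptw (extrap theta) phi n) x * mid theta r n
       + beta * lap (lap (ptw (mid theta) phi n)) x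
       + S1 / eps ^+ 2 * ptw second_diff phi n x
       - S2 * lap (ptw second_diff phi n) x))
  (scheme_r : forall n, (1 <= n)%N ->
     Dtheta theta tau r n =
     2^-1 * integral_box a b (fun x =>
       Hfun alpha eps a b C (ptw (extrap theta) phi n) x *
       ptw (Dtheta theta tau) phi n x))
  (hinit : integral_box a b (phi 1%N) = integral_box a b (phi 0%N)) :
  forall n, integral_box a b (phi n.+1) = integral_box a b (phi n) /\
            integral_box a b (phi n) = integral_box a b (phi 0%N).
Proof.
pose I n := integral_box a b (phi n).
have cphi n : continuous (phi n) := class_C_continuous (phi_regular n).
have cZ k n : continuous (fun x => k * phi n x).
  by move=> x; apply: continuousM; [exact: cst_continuous|exact: cphi].
have step n : (1 <= n)%N -> Dtheta theta tau I n = 0.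
  move=> n1.
  (* [Dtheta] is a linear combination of three terms, so it commutes with integration over the
     box. *)
  have <- : integral_box a b (ptw (Dtheta theta tau) phi n) =
            Dtheta theta tau I n.
    have -> : ptw (Dtheta theta tau) phi n = (fun x => tau^-1 *
        ((theta + 2^-1) * phi n.+1 x +
         (- (2 * theta) * phi n x + (theta - 2^-1) * phi n.-1 x))).
      by apply/funext => x; rewrite /ptw /Dtheta; ring.
    have cD : continuous (fun x => - (2 * theta) * phi n x +
                                   (theta - 2^-1) * phi n.-1 x).
      by move=> x; exact: continuousD (cZ _ _ x) (cZ _ _ x).
    rewrite integral_boxZ; last first.
      by move=> x; exact: continuousD (cZ _ _ x) (cD x).
    rewrite !integral_boxD// !integral_boxZ// /Dtheta /I; ring.
  rewrite (eq_integral_box (scheme_phi n n1)).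
  apply: integral_box_divergence => //; first exact: flux_regular.
  (* The mobility factor is periodic too, being a function of an extrapolation of periodic
     functions. *)
  move=> i x; rewrite !mxE (partial_periodic _ _ (mu_periodic n n1)).
  by rewrite /ptw /extrap !phi_periodic.
(* The leading coefficient is nonzero, so the recurrence determines the newest mass. *)
have th_gt0 : 0 < theta + 2^-1.
  by case/andP: htheta => th _;
    rewrite addr_gt0// (lt_le_trans _ th)// invr_gt0.
(* The recurrence has order two, so two consecutive masses are carried; [hinit] gives the base case.
   As the scheme starts at index 1, it is used at [n.+1]. *)
have Iconst n : I n = I 0 /\ I n.+1 = I 0.
  elim: n => [//|n [In ISn]]; split=> //.
  have /eqP := step n.+1 isT; rewrite /Dtheta /= ISn In.
  rewrite mulf_eq0 invr_eq0 (gt_eqF htau) orbF => /eqP eq0.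
  (* The two older coefficients add up to [- (theta + 2^-1)]. *)
  have : (theta + 2^-1) * (I n.+2 - I 0) = 0 by rewrite -eq0; ring.
  by move/eqP; rewrite mulf_eq0 (gt_eqF th_gt0) /= subr_eq0 => /eqP.
by move=> n; have [In ISn] := Iconst n; split; rewrite // -/(I _) ISn -In.
Qed.
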